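(* Let $(M,\mathcal C)$ be a differential space such that $(M,\tau_{\mathcal C})$ is Hausdorff, and let $\mathcal G$ be a family of generators of $\mathcal C$. If the uniform space $(M,\mathcal U_{\mathcal G})$ is complete, then for every family $\mathcal H$ of generators of $\mathcal C$ with $\mathcal G\subset\mathcal H$ we have $$\mathrm{compl}_{\mathcal H}M=M\quad\text{and}\quad \mathrm{compl}_{\mathcal H}\mathcal C=\mathcal C$$ (under the canonical identification of $M$ with a subset of $\mathrm{compl}_{\mathcal H}M$). In particular $\mathrm{compl}_{\mathcal C}M=M$ and $\mathrm{compl}_{\mathcal C}\mathcal C=\mathcal C$.
   Context: Differential spaces (Sikorski). For a nonempty set $M$ and a family $\mathcal C$ of functions $M\to\mathbb R$, $\tau_{\mathcal C}$ is the weakest topology on $M$ making all functions of $\mathcal C$ continuous. $\mathcal C$ is a differential structure on $M$ if: (a) every $f:M\to\mathbb R$ such that each $m\in M$ has a $\tau_{\mathcal C}$-neighbourhood $V$ and some $\alpha\in\mathcal C$ with $f|_V=\alpha|_V$ belongs to $\mathcal C$; and (b) $\omega\circ(\alpha_1,\dots,\alpha_n)\in\mathcal C$ for all $n\in\mathbb N$, $\omega\in C^\infty(\mathbb R^n)$, $\alpha_1,\dots,\alpha_n\in\mathcal C$. Then $(M,\mathcal C)$ is a differential space. For a family $\mathcal F$ of real functions on $M$, $\mathrm{gen}(\mathcal F)$ is the smallest differential structure on $M$ containing $\mathcal F$; if $\mathcal C=\mathrm{gen}(\mathcal F)$, then $\mathcal F$ is a family of generators of $\mathcal C$. Uniform structure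 of a family of generators. If $\mathcal G$ is a family of generators of $\mathcal C$ and $(M,\tau_{\mathcal C})$ is Hausdorff (equivalently, $\mathcal G$ separates points), then $\mathcal U_{\mathcal G}$ is the uniform structure on $M$ with base consisting of the sets $\{(x,y)\in M\times M: |f_i(x)-f_i(y)|<\varepsilon,\ i=1,\dots,k\}$, $k\in\mathbb N$, $f_1,\dots,f_k\in\mathcal G$, $\varepsilon>0$. A uniform space is complete if each Cauchy filter on it converges. Differential completion. Let $(\widetilde M,\widetilde{\mathcal U}_{\mathcal G})$ be the (Hausdorff) completion of the uniform space $(M,\mathcal U_{\mathcal G})$, with $M$ identified with its canonical dense image in $\widetilde M$. Each $g\in\mathcal G$ has a continuous extension $\tilde g:\widetilde M\to\mathbb R$; put $\widetilde{\mathcal G}=\{\tilde g:g\in\mathcal G\}$. The differential completion of $(M,\mathcal C)$ defined by $\mathcal G$ is $(\mathrm{compl}_{\mathcal G}M,\mathrm{compl}_{\mathcal G}\mathcal C):=(\widetilde M,\mathrm{gen}(\widetilde{\mathcal G}))$. $\mathrm{compl}_{\mathcal C}$ denotes the case where the generating family is $\mathcal C$ itself. The equality $\mathrm{compl}_{\mathcal H}M=M$ means that the canonical embedding of $M$ into $\mathrm{compl}_{\mathcal H}M$ is onto, and $\mathrm{compl}_{\mathcal H}\mathcal C=\mathcal C$ means that the two structures correspond under this bijection. *)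

(* Defs.v *)
From HB Require Import structures.
From mathcomp Require Import all_boot all_order all_algebra.
From mathcomp Require Import finmap.
From mathcomp Require Import all_classical all_reals all_analysis.
Import Order.TTheory GRing.Theory Num.Theory.
Import numFieldNormedType.Exports.

Set Implicit Arguments.
Unset Strict Implicit.
Unset Printing Implicit Defensive.

Local Open Scope classical_set_scope.
Local Open Scope ring_scope.

Section smooth.
Context {R : realType} {n : nat}.

Fixpoint class_C (k : nat) (w : 'rV[R]_n -> R) : Prop :=
  if k is k'.+1 then
    forall i : 'I_n, (forall x, derivable w x (delta_mx 0 i)) /\
                     class_C k' (fun x => 'D_(delta_mx 0 i) w x)
  else continuous w.

Definition smooth (w : 'rV[R]_n -> R) := forall k, class_C k w.

End smooth.

Section differential_structures.
Context {R : realType} {M : choiceType}.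
Implicit Types C F G : set (M -> R).

(* The weakest topology on [M] that makes every function of [C] continuous,
   carried by an alias of [M]. *)
Definition diff_topology C : Type := M.

HB.instance Definition _ C := Choice.on (diff_topology C).
HB.instance Definition _ C := @isSubBaseTopological.Build (diff_topology C)
  ((M -> R) * set R)%type [set fO | C fO.1 /\ open fO.2]
  (fun fO => fO.1 @^-1` fO.2).

Definition diff_structure C : Prop :=
  (forall f : M -> R,
     (forall m : diff_topology C, exists2 V, nbhs m V &
        exists2 a, C a & forall x, V x -> f x = a x) -> C f) /\
  (forall (n : nat) (w : 'rV[R]_n -> R) (a : 'I_n -> M -> R),
     smooth w -> (forall i, C (a i)) -> C (fun m => w (\row_i a i m))).

Lemma cvg_diff_topologyP C (P : set_system M) (m : M) : Filter P ->
  P --> (m : diff_topology C) <-> forall f, C f -> f @ P --> f m.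
Proof.
move=> PF; split=> [cvP f Cf A | cvP A] /=.
  rewrite nbhsE => -[B [Bo Bm] sBA]; apply: cvP.
  rewrite nbhsE; exists (f @^-1` B); last by move=> x /sBA.
  split=> //; exists [set f @^-1` B]; last first.
    by rewrite predeqE => ?; split=> [[_ ->]|] //; exists (f @^-1` B).
  move=> _ ->; exists [fset (f, B)]%fset.
    by move=> ?; rewrite inE inE => /eqP->.
  by rewrite predeqE => ?; split=> [|??]; [move=> /(_ (f, B)); apply|]; rewrite /= inE // => /eqP->.
rewrite (@nbhsE (diff_topology C)).
move=> [_ [[B sB <-] [D BD Dm]] sUBA].
rewrite nbhs_filterE; apply: filterS sUBA _; apply: (@filterS _ _ _ D).
  by move=> ? ?; exists D.
have /sB [F sF IFeD] := BD; rewrite -IFeD; apply: filter_bigI => -[f E] FE.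
have /sF := FE; rewrite inE => -[/= Cf Eo]; apply: (cvP f Cf).
by apply: open_nbhs_nbhs; split=> //; move: Dm; rewrite -IFeD => /(_ _ FE).
Qed.

Definition gen F : set (M -> R) := smallest diff_structure F.

Lemma diff_structure_gen F : diff_structure (gen F).
Proof.
split=> [f fP D [Dds FD]|n w a ws aP D [Dds FD]]; last first.
  by apply: Dds.2 => // i; apply: (aP i); split.
apply: Dds.1 => m; have [V Vm [a Fa fa]] := fP m.
exists V; last by exists a => //; apply: Fa.
suff : nbhs (m : diff_topology D) --> (m : diff_topology (gen F)) by apply.
apply/cvg_diff_topologyP => g Fg.
by apply: (cvg_diff_topologyP D m _).1; [exact: cvg_id|exact: Fg].
Qed.

Definition generates F C : Prop := gen F = C.

Definition family_entourage G : set_system (M * M) :=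
  [set A : set (M * M) | exists (k : nat) (f : 'I_k -> M -> R) (e : R),
    [/\ forall i, G (f i), 0 < e &
        [set xy | forall i, `|f i xy.1 - f i xy.2| < e] `<=` A]].

Local Lemma family_entourage_filter G : Filter (family_entourage G).
Proof.
split.
- by exists 0%N, (fun _ _ => 0), 1; split=> // -[].
- move=> A B [k [f [e [Gf e0 fA]]]] [l [g [d [Gg d0 gB]]]].
  exists (k + l)%N, (fun i => match fintype.split i with inl a => f a | inr b => g b end).
  exists (Num.min e d); split.
  + by move=> i; case: fintype.split.
  + by rewrite lt_min e0.
  + move=> xy xyP; split; [apply: fA => i|apply: gB => i].
    * have := xyP (unsplit (inl i)); rewrite unsplitK lt_min; by case/andP.
    * have := xyP (unsplit (inr i)); rewrite unsplitK lt_min; by case/andP.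
- by move=> A B AB [k [f [e [Gf e0 fA]]]]; exists k, f, e; split=> // xy /fA /AB.
Qed.

Local Lemma family_entourage_diagonal G A :
  family_entourage G A -> (diagonal `<=` A)%classic.
Proof.
move=> [k [f [e [Gf e0 fA]]]] [x y] /diagonalP ->; apply: fA => i /=.
by rewrite subrr normr0.
Qed.

Local Lemma family_entourage_inv G A :
  family_entourage G A -> family_entourage G (A^-1)%relation.
Proof.
move=> [k [f [e [Gf e0 fA]]]]; exists k, f, e; split=> // -[x y] /= xyP.
by apply: fA => i /=; rewrite distrC.
Qed.

Local Lemma family_entourage_split G A :
  family_entourage G A ->
  exists2 B, family_entourage G B & (B \; B `<=` A)%relation.
Proof.
move=> [k [f [e [Gf e0 fA]]]].
exists [set xy | forall i, `|f i xy.1 - f i xy.2| < e / 2].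
  by exists k, f, (e / 2); split=> //; rewrite divr_gt0.
move=> [x y] [z /= xz zy]; apply: fA => i /=.
by rewrite [e]splitr (le_lt_trans (ler_distD (f i z) _ _)) // ltrD.
Qed.

(* The uniform structure with entourages [family_entourage G], carried by an alias of [M]. *)
Definition family_uniform G : Type := M.

HB.instance Definition _ G := Choice.on (family_uniform G).
HB.instance Definition _ G := @isUniform.Build (family_uniform G)
  (family_entourage G) (family_entourage_filter G)
  (@family_entourage_diagonal G) (@family_entourage_inv G)
  (@family_entourage_split G).

End differential_structures.

Section completion.
Implicit Types T N : uniformType.

Definition complete_uniform T :=
  forall F : set_system T, ProperFilter F -> cauchy F -> exists x : T, F --> x.

(* The last condition says that the uniform structure of [T] is the inverse
   image of that of [N]. *)
Definition is_completion T N (j : T -> N) :=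
  [/\ hausdorff_space N, complete_uniform N, dense (range j) &
      forall A : set (T * T), entourage A <->
        exists2 B : set (N * N), entourage B &
          (fun xy => (j xy.1, j xy.2)) @^-1` B `<=` A].

Lemma hausdorff_entourage T : hausdorff_space T <->
  forall x y : T, (forall A, entourage A -> A (x, y)) -> x = y.
Proof.
split=> [hT x y xy | hT x y xy].
  apply: hT => A B Ax; rewrite -nbhs_entourageE => -[E entE EB].
  exists y; split; last by apply: EB; apply/xsectionP; exact: entourage_refl.
  move: Ax; rewrite -nbhs_entourageE => -[D entD DA].
  by apply: DA; apply/xsectionP; exact: xy.
apply: hT => A entA.
have [z []] := xy _ _ (nbhs_entourage x (entourage_split_ent entA))
  (nbhs_entourage y (entourage_inv (entourage_split_ent entA))).
by move=> /xsectionP xz /xsectionP zy; apply: (entourage_split z).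
Qed.

Lemma is_completion_inj T N (j : T -> N) :
  hausdorff_space T -> is_completion j -> injective j.
Proof.
move=> /hausdorff_entourage hT [_ _ _ jP] x y jxy; apply: hT => A /jP[B entB].
by apply; rewrite /= jxy; exact: entourage_refl.
Qed.

End completion.

Section completion_exists.
Variable T : uniformType.

(* The completion realised as the space of minimal Cauchy filters; it witnesses
   that every uniform space has a completion. *)
Definition minimal_cauchy (F : set_system T) :=
  [/\ ProperFilter F, cauchy F &
      forall A, F A -> exists2 E, entourage E &
        exists2 B, F B & forall x y, B x -> E (x, y) -> A y].

Definition cauchy_completion := {F : set_system T | minimal_cauchy F}.

HB.instance Definition _ := gen_eqMixin cauchy_completion.
HB.instance Definition _ := gen_choiceMixin cauchy_completion.

Implicit Types p q : cauchy_completion.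

Local Definition ccE (E : set (T * T)) : set (cauchy_completion * cauchy_completion) :=
  [set pq | exists2 A, sval pq.1 A /\ sval pq.2 A & A `*` A `<=` E].

Local Definition cc_entourage := filter_from (@entourage T) ccE.

Local Lemma cauchyE (F : set_system T) : ProperFilter F -> cauchy F ->
  forall E, entourage E -> exists2 A, F A & A `*` A `<=` E.
Proof.
move=> FF cF E /cF [[A B] /= [FA FB] ABE].
exists (A `&` B); first exact: filterI.
by move=> [x y] [[Ax _] [_ By]]; apply: ABE.
Qed.

Local Lemma cc_pfilter p : ProperFilter (sval p).
Proof. by case: p => F []. Qed.

Local Lemma cc_filter p : Filter (sval p).
Proof. by have [] := cc_pfilter p. Qed.

Local Lemma cc_cauchy p E : entourage E -> exists2 A, sval p A & A `*` A `<=` E.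
Proof. by case: p => F [FF cF _] /=; exact: cauchyE. Qed.

Local Lemma cc_entourage_filter : Filter cc_entourage.
Proof.
apply: filter_from_filter; first by exists setT; exact: entourageT.
move=> A B eA eB; exists (A `&` B); first exact: filterI.
by move=> pq [D DP DAB]; split; exists D => // xy /DAB [].
Qed.

Local Lemma cc_entourage_diagonal A :
  cc_entourage A -> (diagonal `<=` A)%classic.
Proof.
move=> [E entE EA] [p q] /diagonalP ->; apply: EA.
by have [B pB BE] := cc_cauchy q entE; exists B.
Qed.

Local Lemma cc_entourage_inv A : cc_entourage A -> cc_entourage (A^-1)%relation.
Proof.
by move=> [E entE EA]; exists E => // -[p q] [B [? ?] BE]; apply: EA; exists B.
Qed.

Local Lemma meet_square (A B : set T) E : entourage E -> A `&` B !=set0 ->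
  A `*` A `<=` split_ent E -> B `*` B `<=` split_ent E ->
  (A `|` B) `*` (A `|` B) `<=` E.
Proof.
move=> entE [z [Az Bz]] AE BE [x y] [/= xAB yAB]; apply: (entourage_split z) => //.
  by case: xAB => ?; [apply: AE|apply: BE].
by case: yAB => ?; [apply: AE|apply: BE].
Qed.

Local Lemma cc_entourage_split A : cc_entourage A ->
  exists2 B, cc_entourage B & (B \; B `<=` A)%relation.
Proof.
move=> [E entE EA]; exists (ccE (split_ent E)); first by exists (split_ent E).
move=> [p q] [r [B [/= pB rB] BE] [D [/= rD qD] DE]]; apply: EA.
have := (cc_pfilter p, cc_pfilter q, cc_pfilter r) => -[[? ?] ?].
exists (B `|` D).
  by split; [apply: filterS pB|apply: filterS qD] => x ?; [left|right].
apply: meet_square => //; exact: filter_ex (filterI rB rD).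
Qed.

HB.instance Definition _ := @isUniform.Build cauchy_completion
  cc_entourage cc_entourage_filter cc_entourage_diagonal cc_entourage_inv
  cc_entourage_split.

Local Lemma nbhs_minimal_cauchy (x : T) : minimal_cauchy (nbhs x).
Proof.
split; first exact: nbhs_pfilter.
- move=> E entE; exists (xsection (split_ent E)^-1%relation x, xsection (split_ent E) x).
    by split; apply: nbhs_entourage.
  by move=> [y z] [/xsectionP xy /xsectionP xz]; apply: (entourage_split x).
- move=> A; rewrite -nbhs_entourageE => -[E entE EA].
  exists (split_ent E) => //; exists (xsection (split_ent E) x).
    by rewrite nbhs_entourageE; exact: nbhs_entourage.
  move=> y z /xsectionP xy yz; apply: EA; apply/xsectionP.
  exact: entourage_split xy yz.
Qed.

Definition cauchy_embed (x : T) : cauchy_completion :=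
  exist _ _ (nbhs_minimal_cauchy x).

Local Lemma cc_hausdorff : hausdorff_space cauchy_completion.
Proof.
apply/hausdorff_entourage.
have sub p q : (forall A, entourage A -> A (p, q)) -> sval p `<=` sval q.
  move=> pq A pA; have [_ _ /(_ A pA) [E entE [B pB BA]]] := svalP p.
  have [|D [/= pD qD] DE] := pq (ccE E); first by exists E.
  have := (cc_pfilter p, cc_pfilter q) => -[? ?].
  have [z [Bz Dz]] := filter_ex (filterI pB pD).
  by apply: filterS qD => y Dy; apply: BA Bz _; apply: DE.
move=> p q pq; apply: eq_sig_hprop => [? ? ?|]; first exact: Prop_irrelevance; apply/seteqP; split; apply: sub => //.
by move=> A /entourage_inv /pq.
Qed.

Local Lemma cc_dense : dense (range cauchy_embed).
Proof.
move=> O [p Op] oO; have : nbhs p O by exact: open_nbhs_nbhs.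
rewrite -nbhs_entourageE => -[A [E entE EA] AO].
have [B pB BE] := cc_cauchy p entE.
have [_ _ /(_ B pB) [D entD [G pG GB]]] := svalP p.
have := cc_pfilter p => ?; have [x Gx] := filter_ex pG.
exists (cauchy_embed x); split; last by exists x.
apply: AO; apply/xsectionP; apply: EA; exists B => //; split=> //=.
rewrite -nbhs_entourageE; exists D => // y /xsectionP; exact: GB.
Qed.

Local Lemma cc_complete : complete_uniform cauchy_completion.
Proof.
move=> Phi PhiF cPhi.
pose F0 : set_system T := [set A | Phi [set p | sval p A]].
pose F : set_system T := [set A | exists2 E, entourage E &
  exists2 B, F0 B & forall x y, B x -> E (x, y) -> A y].
have F0P : ProperFilter F0.
  apply: Build_ProperFilter_ex.
    move=> A FA; have [p pA] : exists p, sval p A := filter_ex (F := Phi) FA.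
    by have := cc_pfilter p => ?; exact: filter_ex pA.
  split.
  - apply: (filterS (F := Phi)) filterT => p _ /=.
    by have := cc_filter p => ?; exact: filterT.
  - move=> A B FA FB; apply: (filterS (F := Phi)) (filterI (F := Phi) FA FB) => p [pA pB] /=.
    by have := cc_filter p => ?; exact: filterI.
  - move=> A B AB; apply: (filterS (F := Phi)) => p /=; have := cc_filter p => ?.
    exact: filterS.
have FF0 A : F A -> F0 A.
  move=> [E entE [B FB EA]]; apply: filterS FB => x Bx; apply: EA Bx _.
  exact: entourage_refl.
have FP : ProperFilter F.
  apply: Build_ProperFilter_ex; first by move=> A /FF0 /filter_ex.
  split.
  - by exists setT; [exact: entourageT|exists setT => //; exact: filterT].
  - move=> A B [E entE [C FC CA]] [E' entE' [C' FC' CB]].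
    exists (E `&` E'); first exact: filterI.
    exists (C `&` C'); first exact: filterI.
    by move=> x y [Cx C'x] [Exy E'xy]; split; [apply: CA Cx _|apply: CB C'x _].
  - by move=> A B AB [E entE [C FC CA]]; exists E => //; exists C => // x y Cx /(CA _ _ Cx) /AB.
have F0c E : entourage E -> exists2 A, F0 A & A `*` A `<=` E.
  move=> entE; have entE' := entourage_split_ent entE.
  have [P PhiP PE] : exists2 P, Phi P & P `*` P `<=` ccE (split_ent E).
    have [|[P Q] /= [PhiP PhiQ] PQ] := cPhi (ccE (split_ent E)).
      by exists (split_ent E).
    exists (P `&` Q); first exact: filterI.
    by move=> [x y] [[Px _] [_ Qy]]; apply: PQ.
  have [p Pp] := filter_ex PhiP.
  exists (\bigcup_(A in [set A | sval p A /\ A `*` A `<=` split_ent E]) A).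
    apply: filterS PhiP => q Pq; have := cc_filter q => ?.
    have [A [/= pA qA] AE] := PE (p, q) (conj Pp Pq).
    by apply: filterS qA => x Ax; exists A.
  move=> [x y] [[A [pA AE] Ax] [B [pB BE] By]].
  have := cc_pfilter p => ?.
  apply: (meet_square entE (filter_ex (filterI pA pB)) AE BE).
  by split; [left|right].
have Fc E : entourage E -> exists2 A, F A & A `*` A `<=` E.
  move=> entE.
  have entE1 := entourage_split_ent entE.
  have entE2 := entourage_split_ent entE1.
  have [A FA AE] := F0c _ entE2.
  set D := (split_ent (split_ent E) `&` (split_ent (split_ent E))^-1)%relation.
  exists [set y | exists2 x, A x & D (x, y)].
    exists D; first exact: entourage_invI.
    by exists A => // x y Ax Dxy; exists x.
  move=> [y z] [[x Ax [_ yx]] [x' Ax' [xz _]]].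
  apply: (entourage_split x') => //.
    by apply: (entourage_split x) => //; apply: AE.
  exact: split_ent_subset.
have mF : minimal_cauchy F.
  split=> //.
  - move=> E /Fc [A FA AE]; exists (A, A) => //.
  - move=> A [E entE [B FB BA]]; exists (split_ent E) => //.
    exists [set y | exists2 x, B x & split_ent E (x, y)].
      by exists (split_ent E) => //; exists B => // x y Bx ?; exists x.
    by move=> y z [x Bx xy] yz; apply: BA Bx _; apply: (entourage_split y).
exists (exist _ F mF); apply/cvg_entourageP => A [E entE EA].
have [B FB BE] := Fc _ entE.
by apply: (filterS (F := Phi)) (FF0 _ FB) => q qB; apply: EA; exists B.
Qed.

Lemma cauchy_completionP : is_completion cauchy_embed.
Proof.
split; [exact: cc_hausdorff|exact: cc_complete|exact: cc_dense|move=> A; split].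
  move=> entA; exists (ccE A); first by exists A.
  move=> [x y] [B [/= xB yB] BA]; apply: BA.
  by split; exact: nbhs_singleton.
move=> [B [E entE EB] BA].
have entE1 := entourage_split_ent entE.
have entE2 := entourage_split_ent entE1.
pose S := (split_ent (split_ent E) `&` (split_ent (split_ent E))^-1)%relation.
have entS : entourage S by exact: entourage_invI.
apply: filterS (entS) => -[x y] [xy yx]; apply: BA; apply: EB.
exists (xsection S x `|` xsection S y).
  by split; [apply: filterS (nbhs_entourage x entS) => ?; left
            |apply: filterS (nbhs_entourage y entS) => ?; right].
have near z : (xsection S x `|` xsection S y) z ->
    split_ent E (x, z) /\ split_ent E (z, x).
  case=> /xsectionP [xz zx]; first by split; exact: split_ent_subset.
  by split; exact: (entourage_split y).
move=> [z z'] [/= /near [_ zx] /near [xz' _]].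
exact: (entourage_split x).
Qed.

End completion_exists.

Section differential_completion.
Context {R : realType} {M : choiceType}.

(* The continuous extensions to [N] of the members of [H]; they are unique,
   since [range j] is dense. *)
Definition extensions (H : set (M -> R)) (N : uniformType)
    (j : family_uniform H -> N) : set (N -> R) :=
  [set h | continuous h /\ H (h \o j)].

(* The differential structure of the completion of M defined by [H], when [j]
   is the canonical map of M into its uniform completion [N]. *)
Definition compl_structure (H : set (M -> R)) (N : uniformType)
    (j : family_uniform H -> N) : set (N -> R) :=
  gen (extensions j).

End differential_completion.

(* Main.v *)
(** Passing to a larger family of generators refines the uniform structure but
not the topology, which is the one induced by C in both cases.  A point of the
completion defined by H is the limit of a Cauchy filter on M; that filter is
Cauchy for the coarser structure defined by G, hence converges in M by
completeness, and its limit is also a limit for the structure defined by H.  So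
the completion adds no point, and the two differential structures, generated by
corresponding families of functions, correspond. *)
Require Import Defs.
From mathcomp Require Import all_boot all_order all_algebra.
From mathcomp Require Import all_classical all_reals all_analysis.
Import numFieldNormedType.Exports.

Set Implicit Arguments.
Unset Strict Implicit.
Unset Printing Implicit Defensive.

Local Open Scope classical_set_scope.
Local Open Scope ring_scope.

Section diff_structures.
Context {R : realType}.

Lemma gen_subset (M : choiceType) (F D : set (M -> R)) :
  diff_structure D -> F `<=` D -> gen F `<=` D.
Proof. by move=> Dds FD; apply: smallest_sub. Qed.

Lemma subset_gen (M : choiceType) (F : set (M -> R)) : F `<=` gen F.
Proof. exact: sub_gen_smallest. Qed.

(** The weak topology of the continuous functions is coarser than that of [T], so local agreement in
    it with continuous functions still gives continuity on [T]. *)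
Lemma diff_structure_continuous (T : topologicalType) :
  diff_structure [set f : T -> R | continuous f].
Proof.
split=> [f fP x|n w a ws ac x] /=.
  have [V xV [a ac fa]] := fP x.
  have {xV} xV : nbhs (x : T) V.
    suff : nbhs (x : T) -->
      nbhs (x : diff_topology [set f : T -> R | continuous f]) by apply.
    by apply/cvg_diff_topologyP => g; apply.
  rewrite /continuous_at (fa x (nbhs_singleton xV)).
  apply: cvg_trans (ac x); apply: near_eq_cvg.
  by near=> y; apply/esym/fa; near: y.
(* [class_C 0] is continuity; what remains is the row of the [a i], continuous because each of its
   finitely many entries is. *)
apply: (@continuous_comp _ _ _ (fun m => \row_i a i m) w); last exact: (ws 0%N).
move=> A [P Px PA].
suff : \forall y \near x, forall i, P 0 i (a i y).
  by apply: filterS => y Py; apply: PA => i j; rewrite ord1 mxE; exact: Py.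
apply: filter_forall => i; apply: (ac i x).
by have := Px 0 i; rewrite mxE.
Unshelve. all: by end_near. Qed.

(** [phi] is continuous for the two weak topologies, so local agreement pulls back from [N] to [M].
    Combined with [gen_subset], this transports generated structures along a map by looking at
    generators only. *)
Lemma diff_structure_comp (M N : choiceType) (phi : M -> N) (C : set (M -> R)) :
  diff_structure C -> diff_structure [set f : N -> R | C (f \o phi)].
Proof.
set D := [set _ | _]; move=> Cds; split=> [f fP|n w a ws Da]; last exact: Cds.2.
apply: Cds.1 => m; have [V mV [a Da fa]] := fP (phi m).
exists (phi @^-1` V); last by exists (a \o phi) => // x; exact: fa.
suff : phi @ nbhs (m : diff_topology C) -->
  nbhs (phi m : diff_topology D) by apply.
apply/cvg_diff_topologyP => g Dg.
by apply: (cvg_diff_topologyP C m (nbhs_filter (m : diff_topology C))).1 Dg.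
Qed.

End diff_structures.

Section uniform_structures.
Context {R : realType} {M : choiceType}.
Implicit Types G H : set (M -> R).

Lemma entourage_generator G (g : M -> R) (e : R) : G g -> 0 < e ->
  entourage [set xy : family_uniform G * family_uniform G |
    `|g xy.1 - g xy.2| < e].
Proof.
move=> Gg e0; exists 1%N, (fun=> g), e; split=> // xy; apply; exact: ord0.
Qed.

Lemma continuous_generator G (g : M -> R) :
  G g -> continuous (g : family_uniform G -> R).
Proof.
move=> Gg x; apply/(cvgrPdist_lt (FF := nbhs_filter _)) => e e0.
have xV := nbhs_entourage x (entourage_generator Gg e0).
by apply: filterS xV => y /xsectionP.
Qed.

Lemma cvg_family_uniformP G (F : set_system M) (x : M) : Filter F ->
  F --> (x : family_uniform G) <-> forall g, G g -> g @ F --> g x.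
Proof.
move=> FF; split=> [Fx g Gg|Fx].
  by move=> A /(continuous_generator Gg) /Fx.
apply/(@cvg_entourageP (family_uniform G)) => A [k [f [e [Gf e0 fA]]]].
suff : \forall y \near F, forall i, `|f i x - f i y| < e.
  by apply: filterS => y xy; exact: fA.
by apply: filter_forall => i; move/cvgrPdist_lt: (Fx _ (Gf i)); apply.
Qed.

(** Members of [G] lie in [gen G]; conversely, the functions continuous for the uniformity form a
    differential structure containing [G]. Hence the uniform topology depends on [gen G] alone. *)
Lemma nbhs_family_uniform G (x : M) :
  nbhs (x : family_uniform G) = nbhs (x : diff_topology (gen G)).
Proof.
apply/seteqP; split.
  have xF := nbhs_filter (x : diff_topology (gen G)).
  apply/(cvg_family_uniformP G x xF) => g Gg.
  apply: (cvg_diff_topologyP (gen G) x xF).1; first exact: cvg_id.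
  exact: subset_gen.
apply/(cvg_diff_topologyP _ x (nbhs_filter (x : family_uniform G))) => f Gf.
suff /(_ f Gf) : gen G `<=` [set h : family_uniform G -> R | continuous h].
  by apply.
apply: gen_subset => [|g Gg]; last exact: continuous_generator.
exact: (diff_structure_continuous (family_uniform G)).
Qed.

Lemma hausdorff_family_uniform G :
  hausdorff_space (diff_topology (gen G)) -> hausdorff_space (family_uniform G).
Proof.
move=> hG x y xy; apply: hG => A B.
rewrite -2!nbhs_family_uniform; exact: xy.
Qed.

Lemma family_entourageS G H :
  G `<=` H -> family_entourage G `<=` family_entourage H.
Proof.
by move=> GH A [k [f [e [Gf e0 fA]]]]; exists k, f, e; split=> // i; exact: GH.
Qed.

End uniform_structures.

Section completions.
Context {R : realType} {M : choiceType}.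
Implicit Types G H : set (M -> R).

Lemma is_completion_surj G H (N : uniformType) (j : family_uniform H -> N) :
  G `<=` H -> gen G = gen H -> complete_uniform (family_uniform G) ->
  is_completion j -> range j = [set: N].
Proof.
move=> GH gGH cG [hN _ jdense jP]; apply/seteqP; split=> // p _.
(* The trace on [M] of the neighbourhoods of [p], proper because [range j] is dense. *)
pose F : set_system M := filter_from (nbhs p) (fun V => j @^-1` V).
have FF : ProperFilter F.
  apply: filter_from_proper; last first.
    move=> V; rewrite nbhsE => -[U [oU Up] UV].
    have [|q [Uq [x _ xq]]] := jdense U _ oU; first by exists p.
    by exists x; apply: UV; rewrite /= xq.
  apply: filter_from_filter; first by exists setT; exact: filterT.
  by move=> A B pA pB; exists (A `&` B) => //; exact: filterI.
have Fcauchy : cauchy (F : set_system (family_uniform G)).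
  move=> A /(family_entourageS GH) /jP [B entB BA].
  (* The Cauchy component of [minimal_cauchy], for the neighbourhood filter of [p]. *)
  have [_ /(_ B entB) [[U V] /= [pU pV] UVB] _] := svalP (cauchy_embed p).
  exists (j @^-1` U, j @^-1` V); first by split; [exists U|exists V].
  by move=> [x y] [Ux Vy]; apply: BA; exact: UVB.
have [x Fx] := cG F FF Fcauchy.
have {}Fx : F --> (x : family_uniform H).
  by rewrite nbhs_family_uniform -gGH -nbhs_family_uniform.
(* Neighbourhoods of [j x] and of [p] both have preimages in the proper filter [F], so they meet,
   and [N] is Hausdorff. *)
exists x => //; apply: hN => A B jxA pB.
have FA : F (j @^-1` A).
  apply: Fx; move: jxA; rewrite -nbhs_entourageE => -[E entE EA].
  have entjE : entourage ((fun xy => (j xy.1, j xy.2)) @^-1` E).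
    by apply/jP; exists E.
  have xV := nbhs_entourage (x : family_uniform H) entjE.
  apply: filterS xV => y /xsectionP xy.
  by apply: EA; apply/xsectionP.
have FB : F (j @^-1` B) by exists B.
by have [y [Ay By]] := filter_ex (filterI FA FB); exists (j y).
Qed.

Lemma compl_structureE H (N : uniformType) (j : family_uniform H -> N) :
  is_completion j -> injective j -> range j = [set: N] ->
  compl_structure j = [set f : N -> R | gen H (f \o j)].
Proof.
move=> [_ _ _ jP] jinj jsurj; apply/seteqP; split.
  apply: gen_subset.
    exact: (diff_structure_comp (j : M -> N) (diff_structure_gen H)).
  by move=> h [_ Hh]; exact: subset_gen.
have /choice [k jk] : forall p, exists x, j x = p.
  by move=> p; have [x _ <-] : range j p by [rewrite jsurj]; exists x.
have kj : cancel j k by move=> x; apply: jinj; rewrite jk.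
move=> f Hf; rewrite (_ : f = (f \o j) \o k); last first.
  by apply/funext => p /=; rewrite jk.
(* Transport along the inverse [k] of [j]: it suffices that [h \o k] is an extension for each [h] in
   [H]. *)
have := diff_structure_comp (k : N -> M) (diff_structure_gen (extensions j)).
move=> /gen_subset; apply; last exact: Hf.
move=> h Hh; apply: subset_gen; split; last first.
  by rewrite (_ : _ \o j = h)//; apply/funext => x /=; rewrite kj.
move=> p; apply/cvgrPdist_lt => e e0.
(* Entourages on [M] are inverse images under [j] of those on [N], which makes [h \o k]
   continuous. *)
have /jP [B entB Bh] := entourage_generator Hh e0.
apply: filterS (nbhs_entourage p entB) => q /xsectionP Bpq.
by apply: (Bh (k p, k q)); rewrite /= !jk.
Qed.

End completions.

Theorem theorem4p2 (R : realType) (M : choiceType) (C G : set (M -> R))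
    (M_neq0 : [set: M] !=set0)
    (C_diff : diff_structure C)
    (C_hausdorff : hausdorff_space (diff_topology C))
    (G_gen : generates G C)
    (G_complete : complete_uniform (family_uniform G)) :
  (forall H : set (M -> R), generates H C -> G `<=` H ->
     forall (N : uniformType) (j : family_uniform H -> N), is_completion j ->
       range j = [set: N] /\
       compl_structure j = [set f : N -> R | C (f \o j)]) /\
  (forall (N : uniformType) (j : family_uniform C -> N), is_completion j ->
     range j = [set: N] /\
     compl_structure j = [set f : N -> R | C (f \o j)]).
Proof.
have genG : gen G = C := G_gen.
suff main H : generates H C -> G `<=` H ->
    forall (N : uniformType) (j : family_uniform H -> N), is_completion j ->
    range j = [set: N] /\ compl_structure j = [set f : N -> R | C (f \o j)].
  (* The case [H = C]: a differential structure generates itself. *)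
  split=> //; apply: main; last by rewrite -genG; exact: subset_gen.
  by apply/seteqP; split; [exact: gen_subset|exact: subset_gen].
move=> genH GH N j jP; rewrite /generates in genH.
have jsurj : range j = [set: N].
  by apply: (is_completion_surj GH) jP => //; rewrite genG.
split=> //; rewrite -genH; apply: compl_structureE => //.
apply: is_completion_inj jP; apply: hausdorff_family_uniform.
by rewrite genH.
Qed.
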